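(* Let $\mathbb F$ be a field of characteristic different from $2$, let $G=\mathrm{GL}(2,\mathbb F)$, and let $m,n\ge 0$ be integers. Then the following decompositions hold, where the summands are irreducible $\mathbb FG$-modules. (a) If $m+n<\mathrm{char}(\mathbb F)$ or $\mathrm{char}(\mathbb F)=0$, then \[V_m\otimes V_n\cong\bigoplus_{i=0}^{\min(m,n)}V_{\det}^{\otimes i}\otimes V_{m+n-2i}.\] (b) If $0\le 2m<\mathrm{char}(\mathbb F)$ or $\mathrm{char}(\mathbb F)=0$, then \[\wedge^2V_m\cong\bigoplus_{\substack{i=1\\ i\text{ odd}}}^m V_{\det}^{\otimes i}\otimes V_{2m-2i}\quad\text{and}\quad S^2V_m\cong\bigoplus_{\substack{i=0\\ i\text{ even}}}^m V_{\det}^{\otimes i}\otimes V_{2m-2i}.\]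
   Context: The group $\mathrm{GL}(2,\mathbb F)$ acts on $\mathbb F[X,Y]$ by linear substitution: for $A=(a_{ij})$, $\left(\sum\lambda_{ij}X^iY^j\right)A=\sum\lambda_{ij}(a_{11}X+a_{12}Y)^i(a_{21}X+a_{22}Y)^j$. $V_m$ is the $(m+1)$-dimensional $\mathrm{GL}(2,\mathbb F)$-module of homogeneous polynomials of degree $m$. $V_{\det}$ is the $1$-dimensional $\mathrm{GL}(2,\mathbb F)$-module with $vg=(\det g)v$. $\wedge^2V$ and $S^2V$ denote the exterior and symmetric squares of $V$. *)

(* Defs.v *)
From HB Require Import structures.
From mathcomp Require Import all_boot all_order all_fingroup all_algebra.
From mathcomp Require Import mpoly.

Set Implicit Arguments.
Unset Strict Implicit.
Unset Printing Implicit Defensive.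

Import GRing.Theory passmx.
Local Open Scope ring_scope.

(* {'GL_n[R]} and {unit R} only exist over finite rings, so GL(n, F) is
   redefined here for an arbitrary field. *)
Section GeneralLinear.
Variables (n : nat) (F : fieldType).

Record GL := MkGL { GLmx :> 'M[F]_n; _ : GLmx \in unitmx }.

HB.instance Definition _ := [isSub for GLmx].
HB.instance Definition _ := [Choice of GL by <:].

Lemma GLmx_unit (A : GL) : (A : 'M_n) \in unitmx. Proof. exact: valP. Qed.

Lemma GLone_subproof : (1%:M : 'M[F]_n) \in unitmx.
Proof. exact: unitmx1. Qed.
Definition GLone := MkGL GLone_subproof.

Lemma GLinv_subproof (A : GL) : invmx A \in unitmx.
Proof. by rewrite unitmx_inv GLmx_unit. Qed.
Definition GLinv A := MkGL (GLinv_subproof A).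

Lemma GLmul_subproof (A B : GL) : A *m B \in unitmx.
Proof. by rewrite unitmx_mul !GLmx_unit. Qed.
Definition GLmul A B := MkGL (GLmul_subproof A B).

Lemma GLmulA : associative GLmul.
Proof. by move=> A B C; apply: val_inj; apply: mulmxA. Qed.
Lemma GLmul1 : left_id GLone GLmul.
Proof. by move=> A; apply: val_inj; apply: mul1mx. Qed.
Lemma GLmulr1 : right_id GLone GLmul.
Proof. by move=> A; apply: val_inj; apply: mulmx1. Qed.
Lemma GLmulV : left_inverse GLone GLinv GLmul.
Proof. by move=> A; apply: val_inj; apply: mulVmx (GLmx_unit A). Qed.
Lemma GLmulrV : right_inverse GLone GLinv GLmul.
Proof. by move=> A; apply: val_inj; apply: mulmxV (GLmx_unit A). Qed.

HB.instance Definition _ :=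
  isGroup.Build GL GLmulA GLmul1 GLmulr1 GLmulV GLmulrV.

Lemma GLmx1 : (1%g : GL) = 1%:M :> 'M_n. Proof. by []. Qed.
Lemma GLmxM (A B : GL) : (A * B)%g = A *m B :> 'M_n. Proof. by []. Qed.

End GeneralLinear.

(* Finite-dimensional right FG-modules: gact g is v |-> v g, hence the order
   of the factors in gactM. *)
Record gmodule (F : fieldType) (G : groupType) := GModule {
  gspace :> vectType F;
  gact : G -> 'End(gspace);
  gact1 : gact 1%g = \1%VF;
  gactM : forall g h, gact (g * h)%g = (gact h \o gact g)%VF
}.
Arguments gact {F G} V g : rename.

Section ModuleTheory.
Variables (F : fieldType) (G : groupType).
Implicit Types V W : gmodule F G.

Definition ginvariant V (U : {vspace V}) := forall g, (gact V g @: U <= U)%VS.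

Definition girreducible V :=
  {:V}%VS <> 0%VS /\
  forall U : {vspace V}, ginvariant U -> U = 0%VS \/ U = {:V}%VS.

Definition gisomorphic V W :=
  exists2 f : 'Hom(V, W), bijective f &
    forall g v, f (gact V g v) = gact W g (f v).

End ModuleTheory.

Section ZeroTrivial.
Variables (F : fieldType) (G : groupType).

Definition gzero : gmodule F G.
Proof.
refine (@GModule F G 'rV[F]_0 (fun=> \1%VF) _ _) => // g h.
by rewrite comp_lfun1l.
Defined.

Definition gtriv : gmodule F G.
Proof.
refine (@GModule F G F^o (fun=> \1%VF) _ _) => // g h.
by rewrite comp_lfun1l.
Defined.

End ZeroTrivial.

Section DirectSum.
Variables (F : fieldType) (G : groupType) (V W : gmodule F G).

Definition dsum_map (g : G) (u : V * W) : V * W :=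
  (gact V g u.1, gact W g u.2).

Lemma dsum_map_linear g : linear (dsum_map g).
Proof. by move=> a u v; congr pair; apply: linearP. Qed.
HB.instance Definition _ g :=
  GRing.isLinear.Build F (V * W)%type (V * W)%type _ (dsum_map g)
    (dsum_map_linear g).

Definition gdsum : gmodule F G.
Proof.
refine (@GModule F G (V * W)%type (fun g => linfun (dsum_map g)) _ _).
  by apply/lfunP=> -[v w]; rewrite !lfunE /= /dsum_map !gact1 !lfunE.
by move=> g h; apply/lfunP=> -[v w]; rewrite !lfunE /= !lfunE /= /dsum_map
  !gactM !lfunE.
Defined.

End DirectSum.

(* V (x) W is modelled by coordinates: the entry (i, j) is the coefficient on
   e_i (x) f_j, for the bases e, f of V, W chosen by vbasis.  The universal
   property (tens_liftE, tens_ext) shows that the choice is immaterial. *)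
Section Tensor.
Variables (F : fieldType) (V W : vectType F).

Local Notation e := (vbasis {:V}).
Local Notation f := (vbasis {:W}).

Definition tensor : vectType F := 'M[F]_(\dim {:V}, \dim {:W}).

Definition tens (v : V) (w : W) : tensor :=
  (rVof e v)^T *m rVof f w.

Lemma tensDl v1 v2 w : tens (v1 + v2) w = tens v1 w + tens v2 w.
Proof. by rewrite /tens !raddfD /= -mulmxDl. Qed.
Lemma tensDr v w1 w2 : tens v (w1 + w2) = tens v w1 + tens v w2.
Proof. by rewrite /tens linearD mulmxDr. Qed.
Lemma tensZl a v w : tens (a *: v) w = a *: tens v w.
Proof. by rewrite /tens !linearZ /= -scalemxAl. Qed.
Lemma tensZr a v w : tens v (a *: w) = a *: tens v w.
Proof. by rewrite /tens linearZ /= -scalemxAr. Qed.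

Lemma tens0l w : tens 0 w = 0.
Proof. by rewrite -(scale0r 0) tensZl scale0r. Qed.
Lemma tens0r v : tens v 0 = 0.
Proof. by rewrite -(scale0r 0) tensZr scale0r. Qed.
Lemma tens_suml (I : Type) (r : seq I) (P : pred I) (x : I -> V) w :
  tens (\sum_(i <- r | P i) x i) w = \sum_(i <- r | P i) tens (x i) w.
Proof. exact: (big_morph (tens^~ w) (fun x y => tensDl x y w) (tens0l w)). Qed.
Lemma tens_sumr (I : Type) (r : seq I) (P : pred I) v (y : I -> W) :
  tens v (\sum_(i <- r | P i) y i) = \sum_(i <- r | P i) tens v (y i).
Proof. exact: (big_morph (tens v) (tensDr v) (tens0r v)). Qed.

Lemma tens_vbasis i j : tens e`_(val i) f`_(val j) = delta_mx i j.
Proof.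
rewrite /tens !rVofE ?vbasisP //.
by rewrite trmx_delta mul_delta_mx.
Qed.

Lemma tensorE (t : tensor) : t = \sum_i \sum_j t i j *: tens e`_(val i) f`_(val j).
Proof.
rewrite [LHS]matrix_sum_delta; apply: eq_bigr => i _; apply: eq_bigr => j _.
by rewrite tens_vbasis.
Qed.

Lemma tens_ext (U : vectType F) (h k : 'Hom(tensor, U)) :
  (forall v w, h (tens v w) = k (tens v w)) -> h = k.
Proof.
move=> hk; apply/lfunP=> t; rewrite [t]tensorE !linear_sum.
apply: eq_bigr => i _; rewrite !linear_sum; apply: eq_bigr => j _.
by rewrite !linearZ /= hk.
Qed.

Section Lift.
Variables (U : vectType F) (b : V -> W -> U).

Definition tens_lift_map (t : tensor) : U :=
  \sum_i \sum_j t i j *: b e`_(val i) f`_(val j).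

Lemma tens_lift_linear : linear tens_lift_map.
Proof.
move=> a s t; rewrite /tens_lift_map scaler_sumr -big_split.
apply: eq_bigr => i _; rewrite scaler_sumr -big_split.
by apply: eq_bigr => j _; rewrite !mxE scalerDl scalerA.
Qed.
HB.instance Definition _ :=
  GRing.isLinear.Build F tensor U _ tens_lift_map tens_lift_linear.

Definition tens_lift : 'Hom(tensor, U) := linfun tens_lift_map.

Hypotheses (bl : forall w, linear (b^~ w)) (br : forall v, linear (b v)).

Lemma tens_liftE v w : tens_lift (tens v w) = b v w.
Proof.
pose B v : {linear W -> U} := HB.pack (b v) (GRing.isLinear.Build F W U _ _ (br v)).
pose C w : {linear V -> U} := HB.pack (b^~ w) (GRing.isLinear.Build F V U _ _ (bl w)).
rewrite lfunE /= /tens_lift_map.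
transitivity (\sum_i \sum_j (coord e i v * coord f j w) *: b e`_(val i) f`_(val j)).
  by apply: eq_bigr => i _; apply: eq_bigr => j _; rewrite /tens !mxE big_ord1 !mxE.
have := coord_vbasis (memvf v) => {2}->; have := coord_vbasis (memvf w) => {2}->.
rewrite -[RHS]/(C _ _) linear_sum; apply: eq_bigr => i _.
rewrite linearZ /= -[X in _ *: X]/(B _ _) linear_sum scaler_sumr.
by apply: eq_bigr => j _; rewrite linearZ /= scalerA.
Qed.

End Lift.
End Tensor.
Arguments tens {F V W} v w.

Section TensorModule.
Variables (F : fieldType) (G : groupType) (V W : gmodule F G).

Definition tens_map (g : G) : 'End(tensor V W) :=
  tens_lift (fun v w => tens (gact V g v) (gact W g w)).

Lemma tens_mapE g v w : tens_map g (tens v w) = tens (gact V g v) (gact W g w).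
Proof.
apply: tens_liftE => [y|x] a s t; first by rewrite linearP tensDl tensZl.
by rewrite linearP tensDr tensZr.
Qed.

Definition gtens : gmodule F G.
Proof.
refine (@GModule F G (tensor V W) tens_map _ _).
  by apply: tens_ext => v w; rewrite tens_mapE !gact1 !lfunE.
move=> g h; apply: tens_ext => v w.
by rewrite comp_lfunE !tens_mapE !gactM !comp_lfunE.
Defined.

End TensorModule.

Definition gtpow (F : fieldType) (G : groupType) (V : gmodule F G) (k : nat) :
  gmodule F G := iterop k (@gtens F G) V (gtriv F G).

(* V / U is carried by the complement U^C of U, which gquo_proj identifies
   with the quotient by projecting along U (see gquo_proj_ker). *)
Section Quotient.
Variables (F : fieldType) (G : groupType) (V : gmodule F G) (U : {vspace V}).
Hypothesis invU : ginvariant U.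

Definition gquo_space : vectType F := subvs_of (U^C)%VS.

Definition gquo_proj : 'Hom(V, gquo_space) :=
  (linfun (@vsproj F V (U^C)%VS) \o daddv_pi (U^C)%VS U)%VF.

Let capUC : (U^C :&: U)%VS = 0%VS. Proof. by rewrite capvC capv_compl. Qed.

Lemma vsval_gquo_proj v : vsval (gquo_proj v) = daddv_pi (U^C)%VS U v.
Proof. by rewrite !lfunE /= lfunE /= vsprojK // memv_pi. Qed.

Lemma gquo_proj_val (x : gquo_space) : gquo_proj (vsval x) = x.
Proof. by apply: val_inj; rewrite /= vsval_gquo_proj daddv_pi_id ?subvsP. Qed.

Lemma gquo_proj_ker v : (gquo_proj v == 0) = (v \in U).
Proof.
have vE : daddv_pi (U^C)%VS U v + daddv_pi U (U^C)%VS v = v.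
  by apply: daddv_pi_add; rewrite // addvC addv_complf memvf.
apply/eqP/idP => [/(congr1 vsval)|vU].
  by rewrite vsval_gquo_proj -{2}vE => ->; rewrite add0r memv_pi.
apply: val_inj; rewrite /= vsval_gquo_proj.
move: vE; rewrite [daddv_pi U _ v]daddv_pi_id ?capv_compl //.
by move/(canRL (addrK v)); rewrite subrr.
Qed.

Definition gquo_map (g : G) : 'End(gquo_space) :=
  (gquo_proj \o gact V g \o linfun vsval)%VF.

Lemma gquo_mapE g v : gquo_map g (gquo_proj v) = gquo_proj (gact V g v).
Proof.
have -> : gquo_map g (gquo_proj v) =
    gquo_proj (gact V g (vsval (gquo_proj v))).
  by rewrite /gquo_map comp_lfunE [linfun vsval _]lfunE comp_lfunE.
apply/eqP; rewrite -subr_eq0 -!linearB gquo_proj_ker; apply: (subvP (invU g)); apply: memv_img.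
by rewrite -gquo_proj_ker linearB /= gquo_proj_val subrr.
Qed.

Definition gquo : gmodule F G.
Proof.
refine (@GModule F G gquo_space gquo_map _ _).
  by apply/lfunP=> x; rewrite -[x]gquo_proj_val gquo_mapE gact1 !lfunE.
move=> g h; apply/lfunP=> x.
by rewrite -[x]gquo_proj_val comp_lfunE !gquo_mapE gactM comp_lfunE.
Defined.

End Quotient.

Section Squares.
Variables (F : fieldType) (G : groupType) (V : gmodule F G).

Local Notation e := (vbasis {:V}).

(* The subspace spanned by all v (x) v (see ext_relP); the generators come
   from expanding v in the basis e, since v ranges over an infinite set. *)
Definition ext_rel : {vspace gtens V V} :=
  <<([seq tens x x | x <- e] ++
     [seq tens x y + tens y x | x <- e, y <- e])%R>>%VS.

(* The subspace spanned by all v (x) w - w (x) v (see sym_relP). *)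
Definition sym_rel : {vspace gtens V V} :=
  <<[seq (tens x y - tens y x)%R | x <- e, y <- e]>>%VS.

Lemma ext_relP (U : {vspace gtens V V}) :
  (ext_rel <= U)%VS <-> (forall v : V, tens v v \in U).
Proof.
split=> [/subvP sU v|tU]; last first.
  apply/span_subvP=> t; rewrite mem_cat => /orP[/mapP[x _ ->] //|].
  case/allpairsP=> -[x y] /= [_ _ ->].
  have -> : tens x y + tens y x =
      tens (x + y) (x + y) - tens x x - tens y y :> tensor V V.
    rewrite tensDl !tensDr -[X in X - _ - _]addrA [tens x x + _]addrC addrK.
    by rewrite addrA addrK.
  by rewrite !rpredB ?tU.
apply: sU; rewrite (coord_vbasis (memvf v)).
have sum2 n (x : 'I_n -> V) :
    (forall i, tens (x i) (x i) \in ext_rel) ->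
    (forall i j, tens (x i) (x j) + tens (x j) (x i) \in ext_rel) ->
    tens (\sum_i x i) (\sum_i x i) \in ext_rel.
  elim: n x => [|n IHn] x xx xy.
    by rewrite big_ord0 tens0l mem0v.
  rewrite big_ord_recl tensDl !tensDr -!addrA rpredD ?xx //.
  rewrite addrA; apply: rpredD; last by apply: IHn => *; [exact: xx | exact: xy].
  rewrite tens_sumr tens_suml -big_split /=.
  by rewrite rpred_sum.
have memB t : t \in [seq tens x x | x <- e] ++ [seq tens x y + tens y x | x <- e, y <- e]
  -> t \in ext_rel by move/memv_span.
apply: sum2 => [i|i j]; rewrite !(tensZl, tensZr).
  do 2!apply: rpredZ; apply: memB; rewrite mem_cat; apply/orP; left.
  by apply: (map_f (fun x : V => tens x x)); apply: memt_nth.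
rewrite !scalerA [X in _ + X *: _]mulrC -scalerDr.
apply: rpredZ; apply: memB; rewrite mem_cat; apply/orP; right.
by apply: (allpairs_f (fun x y : V => tens x y + tens y x)); apply: memt_nth.
Qed.

Lemma sym_relP (U : {vspace gtens V V}) :
  (sym_rel <= U)%VS <-> (forall v w : V, tens v w - tens w v \in U).
Proof.
split=> [/subvP sU v w|tU]; last first.
  by apply/span_subvP=> t /allpairsP[[x y] /= [_ _ ->]].
apply: sU; rewrite (coord_vbasis (memvf v)) (coord_vbasis (memvf w)).
rewrite tens_suml tens_sumr -sumrB rpred_sum // => i _.
rewrite tens_sumr tens_suml -sumrB rpred_sum // => j _.
rewrite !(tensZl, tensZr) !scalerA [X in _ - X *: _]mulrC -scalerBr rpredZ //.
apply: memv_span.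
by apply: (allpairs_f (fun x y : V => tens x y - tens y x)); apply: memt_nth.
Qed.

Lemma ext_rel_invariant : ginvariant ext_rel.
Proof.
move=> g; have [/(_ (subvv _)) tt _] := ext_relP ext_rel.
suff /subvP s : (ext_rel <= gact (gtens V V) g @^-1: ext_rel)%VS.
  by apply/subvP=> _ /memv_imgP[t /s + ->]; rewrite memv_preim.
by apply/ext_relP=> v; rewrite -memv_preim /= tens_mapE.
Qed.

Lemma sym_rel_invariant : ginvariant sym_rel.
Proof.
move=> g; have [/(_ (subvv _)) tt _] := sym_relP sym_rel.
suff /subvP s : (sym_rel <= gact (gtens V V) g @^-1: sym_rel)%VS.
  by apply/subvP=> _ /memv_imgP[t /s + ->]; rewrite memv_preim.
by apply/sym_relP=> v w; rewrite -memv_preim /= linearB /= !tens_mapE.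
Qed.

Definition gext2 : gmodule F G := gquo ext_rel_invariant.
Definition gsym2 : gmodule F G := gquo sym_rel_invariant.

End Squares.

Section DetModule.
Variable F : fieldType.

Definition Vdet : gmodule F (GL 2 F).
Proof.
refine (@GModule F (GL 2 F) F^o (fun A => \det A *: \1%VF) _ _).
  by rewrite det1 scale1r.
by move=> A B; rewrite det_mulmx -comp_lfunZl -comp_lfunZr comp_lfun1l scalerA mulrC.
Defined.

End DetModule.

(* 'X_0 and 'X_1 are the variables X and Y. *)
Section HomogeneousPolynomials.
Variables (F : fieldType) (m : nat).
Implicit Types (A : GL 2 F) (p : {mpoly F[2]}).

Definition linsubst A p : {mpoly F[2]} :=
  p \mPo [tuple \sum_j (A i j)%:MP * 'X_j | i < 2].

Lemma linsubst_homog A p : p \is m.-homog -> linsubst A p \is m.-homog.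
Proof.
move=> /dhomogP hp; rewrite /linsubst comp_mpolyE big_seq rpred_sum // => k kp.
apply: rpredZ; rewrite -(hp k kp) /= mdegE !big_ord_recl !big_ord0 mulr1 addn0.
have lin i : tnth [tuple \sum_j (A i j)%:MP * 'X_j | i < 2] i \is 1.-homog.
  rewrite tnth_mktuple rpred_sum // => j _; rewrite mul_mpolyC; apply: rpredZ.
  by rewrite dhomogX /= mdeg1.
by apply: dhomogM; rewrite -[X in X.-homog]mul1n; apply: dhomogMn.
Qed.

Definition Vhom_map A (p : dhomog 2 F m) : dhomog 2 F m :=
  DHomog (linsubst_homog A (dhomog_is_dhomog p)).

Lemma Vhom_map_linear A : linear (Vhom_map A).
Proof. by move=> a p q; apply: val_inj; apply: linearP. Qed.
HB.instance Definition _ A :=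
  GRing.isLinear.Build F (dhomog 2 F m) (dhomog 2 F m) _ (Vhom_map A)
    (Vhom_map_linear A).

Lemma linsubst1 p : linsubst 1%g p = p.
Proof.
rewrite /linsubst -[RHS]comp_mpoly_id; congr (_ \mPo _).
apply: eq_from_tnth => i; rewrite !tnth_mktuple (bigD1 i) //= mxE eqxx mul1r.
by rewrite big1 ?addr0 // => j /negbTE ji; rewrite mxE eq_sym ji mpolyC0 mul0r.
Qed.

Lemma linsubstM A B p : linsubst (A * B)%g p = linsubst B (linsubst A p).
Proof.
rewrite [LHS]comp_mpolyE [linsubst A p]comp_mpolyE [RHS]raddf_sum /=.
apply: eq_bigr => k _; rewrite comp_mpolyZ rmorph_prod; congr (_ *: _).
apply: eq_bigr => i _; rewrite rmorphXn /= !tnth_mktuple; congr (_ ^+ _).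
rewrite raddf_sum /=.
under [RHS]eq_bigr => j _ do
  rewrite rmorphM /= comp_mpolyC comp_mpolyXU -tnth_nth tnth_mktuple mulr_sumr.
rewrite exchange_big; apply: eq_bigr => j _; rewrite mxE raddf_sum mulr_suml.
by apply: eq_bigr => l _; rewrite /= mpolyCM mulrA.
Qed.

Definition Vhom : gmodule F (GL 2 F).
Proof.
refine (@GModule F (GL 2 F) (dhomog 2 F m) (fun A => linfun (Vhom_map A)) _ _).
  by apply/lfunP=> p; rewrite !lfunE; apply: val_inj; apply: linsubst1.
move=> A B; apply/lfunP=> p; rewrite comp_lfunE !lfunE.
by apply: val_inj; apply: linsubstM.
Defined.

End HomogeneousPolynomials.

(* Main.v *)
Require Import Defs.
From HB Require Import structures.
From mathcomp Require Import all_boot all_order all_fingroup all_algebra.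
From mathcomp Require Import mpoly ring.

(* For binary forms f, g put T_0(f, g) = f g and
   T_(i+1)(f, g) = T_i(f_X, g_Y) - T_i(f_Y, g_X).  By the chain rule
   T_i(f A, g A) = (det A)^i T_i(f, g) A, so the i-th transvectant T_i is a
   G-map from V_m (x) V_n to det^i (x) V_(m+n-2i).  These maps are jointly
   bijective for i <= min(m, n): since T_(i+1) is T_i after the operator
   Omega = d_X (x) d_Y - d_Y (x) d_X to V_(m-1) (x) V_(n-1), it is enough that
   (T_0, Omega) is injective, the dimensions being equal.  On a tensor killed by
   Omega the coefficient of X^a Y^(m-a) (x) X^b Y^(n-b) is proportional to
   'C(m, a) 'C(n, b) for a + b = w fixed, and T_0 multiplies the factor by
   'C(m + n, w), which is nonzero in F.

   As T_i(g, f) = (-1)^i T_i(f, g), the odd T_i factor through the exterior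
   square and the even ones through the symmetric square; a tensor t killed by
   all those of one parity equals (t - s)/2 or (t + s)/2, s being its image
   under the exchange of the two factors.

   V_k is irreducible because f(X + Y, Y) - f(X, Y) has X-degree exactly one less
   than f: a nonzero submodule contains Y^k, hence X^k, hence forms of every
   X-degree. *)

Set Implicit Arguments.
Unset Strict Implicit.
Unset Printing Implicit Defensive.

Import GRing.Theory.
(* all_fingroup shadows [gact]. *)
Import Defs.
Local Open Scope ring_scope.

(** * Linear algebra and modules *)

Section LinearMaps.
Variables (F : fieldType) (V W : vectType F) (f : 'Hom(V, W)).

Hypothesis f_inj : forall v, f v = 0 -> v = 0.

Let kerf0 : lker f == 0%VS.
Proof.
rewrite -subv0; apply/subvP=> v; rewrite memv_ker => /eqP/f_inj->.
exact: mem0v.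
Qed.

Lemma lfun_bij : (forall w, exists v, f v = w) -> bijective f.
Proof.
move=> f_surj; exists (f^-1)%VF => [|w]; first exact: lker0_lfunK.
by have [v <-] := f_surj w; rewrite lker0_lfunK.
Qed.

Lemma lfun_inj_dim_surj : \dim {:V} = \dim {:W} -> forall w, exists v, f v = w.
Proof.
move=> dimVW w; have : w \in limg f.
  have cap0 : (fullv :&: lker f = 0)%VS by rewrite (eqP kerf0) capv0.
  suff /eqP-> : limg f == fullv by exact: memvf.
  by rewrite eqEdim subvf (limg_dim_eq cap0) dimVW /=.
by case/memv_imgP=> v _ ->; exists v.
Qed.

End LinearMaps.

Section Pairing.
Variables (F : fieldType) (U V W : vectType F) (f : 'Hom(U, V)) (g : 'Hom(U, W)).

Definition pair_map (u : U) : V * W := (f u, g u).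

Lemma pair_map_linear : linear pair_map.
Proof. by move=> a u v; rewrite /pair_map !linearP. Qed.
HB.instance Definition _ :=
  GRing.isLinear.Build F U (V * W)%type _ pair_map pair_map_linear.

Definition lfun_pair : 'Hom(U, (V * W)%type) := linfun pair_map.

Lemma lfun_pairE u : lfun_pair u = (f u, g u).
Proof. by rewrite lfunE. Qed.

Lemma dim_pair : \dim {:(V * W)%type} = (\dim {:V} + \dim {:W})%N.
Proof. by rewrite !dimvf. Qed.

End Pairing.

Section TensorMaps.
Variables (F : fieldType) (V W : vectType F).

(** Pure tensors span; no separate case for 0 arises, since 0 is itself a pure tensor. *)
Lemma tens_ind (P : tensor V W -> Prop) :
    (forall v w, P (tens v w)) -> (forall a s t, P s -> P t -> P (a *: s + t)) ->
  forall t, P t.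
Proof.
move=> Pvw PL t; rewrite [t]tensorE.
have P0 : P 0 by rewrite -(tens0l V 0).
have PD s u : P s -> P u -> P (s + u) by move=> Ps; rewrite -[s]scale1r; apply: PL.
apply: big_ind => // i _; apply: big_ind => // j _.
by rewrite -[_ *: _]addr0; apply: PL.
Qed.

Lemma dim_tensor : \dim {:tensor V W} = (\dim {:V} * \dim {:W})%N.
Proof. by rewrite [LHS]dimvf. Qed.

End TensorMaps.

Section ModuleMaps.
Variables (F : fieldType) (G : groupType).
Implicit Types U V W : gmodule F G.

(** The iterated sum is a nested product whose type depends on [r]. This criterion replaces its
    projections by a family of maps [f i] that is jointly injective and jointly surjective. *)
Lemma gisomorphic_bigdsum U (W : nat -> gmodule F G) (r : seq nat)
    (P : pred nat) (f : forall i, 'Hom(U, W i)) :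
    uniq r ->
    (forall i, P i -> forall g u, f i (gact U g u) = gact (W i) g (f i u)) ->
    (forall u, (forall i, i \in r -> P i -> f i u = 0) -> u = 0) ->
    (forall w : forall i, W i,
       exists u, forall i, i \in r -> P i -> f i u = w i) ->
  gisomorphic U (\big[@gdsum F G/gzero F G]_(i <- r | P i) W i).
Proof.
move=> r_uniq f_act f_inj f_surj.
(* Joint injectivity and surjectivity refer to the whole list and do not pass to its tail. The
   induction therefore only builds [h] and reduces its kernel and its values to those of the
   [f i]. *)
have [h [h_act h_inj h_surj]] :
    exists h : 'Hom(U, \big[@gdsum F G/gzero F G]_(i <- r | P i) W i),
    [/\ forall g u, h (gact U g u) = gact _ g (h u),
        forall u, h u = 0 -> forall i, i \in r -> P i -> f i u = 0
      & forall y, exists w : forall i, W i, forall u,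
          (forall i, i \in r -> P i -> f i u = w i) -> h u = y].
  elim: r r_uniq {f_inj f_surj} => [_|i r IHr /= /andP[ir r_uniq]].
    rewrite big_nil; exists 0; split=> // [g u|y].
      by rewrite !lfunE.
    by exists (fun i => 0) => u _; apply/rowP=> -[].
  have [h [h_act h_inj h_surj]] := IHr r_uniq.
  rewrite big_cons; case: ifPn => [Pi|nPi]; last first.
    exists h; split=> // [u hu0 j|y].
      by rewrite inE => /predU1P[->|jr Pj]; [rewrite (negPf nPi) | apply: h_inj].
    have [w wP] := h_surj y; exists w => u fu; apply: wP => j jr.
    by apply: fu; rewrite inE jr orbT.
  exists (lfun_pair (f i) h); split=> [g u|u|[x y]].
  - by rewrite !lfun_pairE lfunE /= /dsum_map /= f_act // h_act.
  - rewrite lfun_pairE => -[fu0 hu0] j; rewrite inE => /predU1P[->|jr Pj] //.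
    exact: h_inj.
  (* [dfwith w x] prescribes [x] at index [i]; as [i] does not recur in [r], the values prescribed
     on the tail are unchanged. *)
  - have [w wP] := h_surj y; exists (dfwith w x) => u fu; rewrite lfun_pairE.
    congr (_, _); first by rewrite fu ?mem_head // dfwith_in.
    apply: wP => j jr Pj; rewrite fu ?inE ?jr ?orbT // dfwith_out //.
    by apply: contraNneq ir => ->.
exists h => //; apply: lfun_bij => [u /h_inj|y]; first exact: f_inj.
by have [w wP] := h_surj y; have [u /wP] := f_surj w; exists u.
Qed.

(** Subspaces are closed under scalars, so a bijection that is equivariant only up to nonzero
    scalars still pulls invariant subspaces back to invariant subspaces. *)
Lemma girreducible_twist V W (f : 'Hom(V, W)) (chi : G -> F) :
    bijective f -> (forall g, chi g != 0) ->
    (forall g v, gact W g (f v) = chi g *: f (gact V g v)) ->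
  girreducible V -> girreducible W.
Proof.
move=> [h fK hK] chi0 f_act [V0 V_irr].
have ker0 : lker f == 0%VS by apply/lker0P/(can_inj fK).
have imgf : limg f = {:W}%VS.
  by apply/vspaceP=> w; rewrite memvf -[w]hK memv_img ?memvf.
split=> [W0|U U_inv].
  apply: V0; apply/vspaceP=> v; rewrite memvf memv0; apply/esym/eqP.
  apply: (can_inj fK); rewrite linear0; apply/eqP.
  by rewrite -memv0 -W0 memvf.
have UE : U = (f @: (f @^-1: U))%VS.
  by rewrite lpreimK // imgf subvf.
case: (V_irr (f @^-1: U)%VS) => [g|U0|U1].
- apply/subvP=> _ /memv_imgP[v vU ->]; move: vU; rewrite -!memv_preim => fvU.
  rewrite -[f _]scale1r -(mulVf (chi0 g)) -scalerA -f_act rpredZ //.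
  exact/(subvP (U_inv g))/memv_img.
- by left; rewrite UE U0 limg0.
- by right; rewrite UE U1.
Qed.

End ModuleMaps.

Section Quotient.
Variables (F : fieldType) (G : groupType) (V W : gmodule F G).
Variables (U : {vspace V}) (invU : ginvariant U) (f : 'Hom(V, W)).
Hypothesis f_act : forall g v, f (gact V g v) = gact W g (f v).
Hypothesis fU0 : forall v, v \in U -> f v = 0.

Definition gquo_lift : 'Hom(gquo invU, W) := (f \o linfun vsval)%VF.

(** The chosen representative of the class of [v] differs from [v] by an element of [U], which [f]
    kills. *)
Lemma gquo_liftE v : gquo_lift (gquo_proj U v) = f v.
Proof.
rewrite comp_lfunE lfunE /=; apply/eqP; rewrite -subr_eq0 -linearB.
apply/eqP/fU0; rewrite -gquo_proj_ker linearB subr_eq0.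
by apply/eqP; rewrite /= gquo_proj_val.
Qed.

Lemma gquo_lift_act g x :
  gquo_lift (gact (gquo invU) g x) = gact W g (gquo_lift x).
Proof.
rewrite -[x]gquo_proj_val [gact (gquo invU) g _](gquo_mapE invU).
by rewrite [LHS]gquo_liftE f_act [in RHS]gquo_liftE.
Qed.

End Quotient.

Section Twist.
Variables (F : fieldType) (G : groupType).
Implicit Types (L M W : gmodule F G) (chi psi : G -> F).

(** A line with basis vector [d] and character [chi]. The functional [l] both certifies that [d] is
    nonzero and provides the contraction that inverts [gtwist]. *)
Definition gline L chi (d : L) :=
  [/\ forall g, gact L g d = chi g *: d, forall v, exists c, v = c *: d
    & exists l : 'Hom(L, F^o), l d = 1].

Lemma tens_line_span L W (d : L) (t : gtens L W) :
  (forall v, exists c, v = c *: d) -> exists w, t = tens d w.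
Proof.
move=> d_span; elim/(@tens_ind _ L W): t => [v w|a s t [x ->] [y ->]].
  by have [c ->] := d_span v; exists (c *: w); rewrite tensZl tensZr.
by exists (a *: x + y); rewrite tensDr tensZr.
Qed.

Lemma gline_tens L M chi psi (d : L) (e : M) :
    gline chi d -> gline psi e ->
  @gline (gtens L M) (fun g => chi g * psi g) (tens d e).
Proof.
move=> [d_act d_span [l ld]] [e_act e_span [k ke]]; split=> [g|t|].
- by rewrite [LHS]tens_mapE d_act e_act tensZl tensZr scalerA.
- have [v ->] := tens_line_span t d_span; have [c ->] := e_span v.
  by exists c; rewrite tensZr.
exists (tens_lift (fun v w => l v * k w : F^o)).
rewrite tens_liftE ?ld ?ke ?mulr1 // => [w|v] a x y; rewrite linearP.
  by rewrite mulrDl -scalerAl.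
by rewrite mulrDr scalerAr.
Qed.

Section TensLine.
Variables (L W : gmodule F G) (chi : G -> F) (d : L).
Hypothesis dP : gline chi d.

Lemma tens_linear : linear (tens d : W -> tensor L W).
Proof. by move=> a v w; rewrite tensDr tensZr. Qed.
HB.instance Definition _ :=
  GRing.isLinear.Build F W (tensor L W) _ (tens d) tens_linear.

Definition gtwist : 'Hom(W, gtens L W) := linfun (tens d).

Lemma gtwistE w : gtwist w = tens d w.
Proof. by rewrite lfunE. Qed.

Lemma gtwist_act g w :
  gact (gtens L W) g (gtwist w) = chi g *: gtwist (gact W g w).
Proof. by have [d_act _ _] := dP; rewrite !gtwistE [LHS]tens_mapE d_act tensZl. Qed.

Lemma gtwist_bij : bijective gtwist.
Proof.
have [_ d_span [l ld]] := dP; apply: lfun_bij => [w|t].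
  (* Contracting the first factor with [l] is a left inverse, because [l d = 1]. *)
  have wE : tens_lift (fun v w => l v *: w) (gtwist w) = w.
    rewrite gtwistE tens_liftE ?ld ?scale1r // => [y|v] a s u.
      by rewrite linearP scalerDl scalerA.
    by rewrite scalerDr !scalerA mulrC.
  by move=> w0; rewrite -wE w0 linear0.
by have [w ->] := tens_line_span t d_span; exists w; rewrite gtwistE.
Qed.

End TensLine.
End Twist.

(** A sigma type, so that the basis vector can enter the definition of [cg_map]. *)
Lemma gline_det (F : fieldType) i :
  {d : gtpow (Vdet F) i | gline (fun A : GL 2 F => \det A ^+ i) d}.
Proof.
have d1P : @gline F _ (Vdet F) (fun A : GL 2 F => \det A ^+ 1) (1 : F^o).
  split=> [A|v|]; first by rewrite /= scale_lfunE lfunE.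
    by exists v; rewrite [RHS]mulr1.
  by exists \1%VF; rewrite lfunE.
(* Since [gtpow] is an [iterop], its first power is [Vdet] itself and not [Vdet] tensored with the
   trivial module; hence two base cases. *)
elim: i => [|[|i] [d dP]].
- exists (1 : F^o); split=> [A|v|]; first by rewrite lfunE scale1r.
    by exists v; rewrite [RHS]mulr1.
  by exists \1%VF; rewrite lfunE.
- by exists (1 : F^o).
have [act sp du] := gline_tens d1P dP.
by exists (tens (1 : F^o) d); split=> // A; rewrite act -exprS.
Qed.

(** * Transvectants *)

Lemma big_ord2 (R : Type) (idx : R) (op : Monoid.law idx) (f : 'I_2 -> R) :
  \big[op/idx]_(i < 2) f i = op (f ord0) (f ord_max).
Proof.
rewrite big_ord_recr big_ord1; congr (op (f _) _).
exact: val_inj.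
Qed.

Lemma det_mx2 (R : comNzRingType) (A : 'M[R]_2) :
  \det A = A ord0 ord0 * A ord_max ord_max - A ord0 ord_max * A ord_max ord0.
Proof.
rewrite (expand_det_row _ ord0) big_ord2 /cofactor !det_mx11 !mxE /=.
rewrite expr0 expr1 mul1r mulN1r mulrN.
by congr (_ * A _ _ - _ * A _ _); apply: val_inj.
Qed.

Section Derivatives.
Variable F : fieldType.
Implicit Types (p q : {mpoly F[2]}).

Lemma mderiv_homog m i p : p \is m.-homog -> p^`M(i) \is m.-1.-homog.
Proof.
move=> /dhomogP hp; rewrite [p]mpolyE raddf_sum big_seq rpred_sum // => u up.
rewrite /= mderivZ mderivX rpredZ // -(hp u up) /=.
have [->|ui] := eqVneq (u i) 0%N.
  by rewrite scale0r dhomog0.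
have uE : u = (u - U_(i) + U_(i))%MM by rewrite submK // lep1mP.
by rewrite rpredZ // dhomogX /= [in X in _ == X]uE mdegD mdeg1 addn1.
Qed.

Lemma mderiv_homog0 i p : p \is 0.-homog -> p^`M(i) = 0.
Proof.
move=> /dhomogP hp; rewrite [p]mpolyE raddf_sum big_seq big1 // => u up.
have /eqP := hp u up; rewrite /= mdeg_eq0 => /eqP->.
by rewrite mderivZ mpolyX0 mderivC scaler0.
Qed.

HB.instance Definition _ (A : GL 2 F) :=
  GRing.Linear.copy (linsubst A)
    (comp_mpoly [tuple \sum_j (A i j)%:MP * 'X_j | i < 2]).
HB.instance Definition _ (A : GL 2 F) :=
  GRing.RMorphism.copy (linsubst A)
    (comp_mpoly [tuple \sum_j (A i j)%:MP * 'X_j | i < 2]).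

(** The chain rule. The property [D] is closed under products and linear combinations, so it is
    enough to check it on 1 and on the variables. *)
Lemma mderiv_linsubst (A : GL 2 F) j p :
  (linsubst A p)^`M(j) = \sum_i A i j *: linsubst A p^`M(i).
Proof.
pose D p := (linsubst A p)^`M(j) = \sum_i A i j *: linsubst A p^`M(i).
have DM q r : D q -> D r -> D (q * r).
  rewrite /D [linsubst A (q * r)]rmorphM mderivM => -> ->.
  rewrite mulr_suml mulr_sumr -big_split /=; apply: eq_bigr => i _.
  rewrite mderivM [linsubst A (_ + _)]raddfD /= ![linsubst A (_ * _)]rmorphM /=.
  by rewrite scalerDr scalerAl scalerAr.
have D1 : D 1.
  rewrite /D [linsubst A 1]rmorph1 mderivC big1 // => i _.
  by rewrite mderivC [linsubst A 0]raddf0 scaler0.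
have DX i : D 'X_i.
  have lin k : linsubst A 'X_k = \sum_l (A k l)%:MP * 'X_l.
    by rewrite /linsubst comp_mpolyXU -tnth_nth tnth_mktuple.
  rewrite /D lin raddf_sum /=.
  have dX l k : ('X_l)^`M(k) = (l == k)%:R :> {mpoly F[2]}.
    rewrite mderivX mnmE; have [->|_] := eqVneq l k; last by rewrite scale0r.
    by rewrite scale1r -[X in (X - _)%MM]add0m addmK mpolyX0.
  rewrite (bigD1 j) //= big1 => [|l lj]; last first.
    by rewrite mderiv_mulC dX (negPf lj) mulr0.
  rewrite (bigD1 i) //= [X in _ = _ + X]big1 => [|l li]; last first.
    by rewrite dX eq_sym (negPf li) raddf0 scaler0.
  by rewrite mderiv_mulC !dX !eqxx mulr1 rmorph1 !addr0 alg_mpolyC.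
have DL a q r : D q -> D r -> D (a *: q + r).
  rewrite /D [linsubst A (_ + _)]linearP /= mderivD mderivZ => -> ->.
  rewrite scaler_sumr -big_split /=; apply: eq_bigr => i _.
  by rewrite mderivD mderivZ [linsubst A (_ + _)]linearP /= scalerDr !scalerA mulrC.
have DXm (u : 'X_{1..2}) : D 'X_[u].
  rewrite mpolyXE_id; apply: (big_ind D D1 DM) => i _.
  elim: (u i) => [|k IHk]; first by rewrite expr0.
  by rewrite exprS; apply: (DM _ _ (DX i) IHk).
have D0 : D 0 by have := DL (-1) 1 1 D1 D1; rewrite scaleN1r addNr.
by elim/mpolyind: p => [|a u p _ _ IHp]; [exact: D0 | exact: (DL _ _ _ (DXm u) IHp)].
Qed.

End Derivatives.

(** The source of the determinant: with [p, q] and [p', q'] the partial derivatives of two forms,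
    the terms [h p p'] and [h q q'] cancel after the substitution. Each step of a transvectant thus
    gains one factor [det A]. *)
Lemma bilinear_det (F : fieldType) (U V : lmodType F) (h : U -> U -> V) :
    (forall v, linear (h^~ v)) -> (forall u, linear (h u)) ->
  forall a b c d (p q p' q' : U),
    h (a *: p + c *: q) (b *: p' + d *: q')
    - h (b *: p + d *: q) (a *: p' + c *: q') =
    (a * d - b * c) *: (h p q' - h q p').
Proof.
move=> hl hr a b c d p q p' q'.
have h0r u : h u 0 = 0.
  by have := hr u (-1) 0 0; rewrite scaler0 addr0 scaleN1r addNr.
have h0l v : h 0 v = 0.
  by have := hl v (-1) 0 0; rewrite scaler0 addr0 scaleN1r addNr.
have Zr x u v : h u (x *: v) = x *: h u v.
  by rewrite -[x *: v]addr0 hr h0r addr0.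
have Zl x u v : h (x *: u) v = x *: h u v.
  by rewrite -[x *: u]addr0 hl h0l addr0.
rewrite !hl !hr !Zl !Zr !scalerDr !scalerA [b * a]mulrC [d * c]mulrC.
rewrite opprD addrACA ![- (_ + _)]opprD [X in X + _]addrACA [X in _ + X]addrACA.
rewrite !subrr add0r addr0.
by rewrite -!scalerBl -[b * c - _]opprB scaleNr scalerN.
Qed.

Lemma subn_double_addSS m n i : (m.+1 + n.+1 - 2 * i.+1 = m + n - 2 * i)%N.
Proof. by rewrite mulnS addSn addnS -[in LHS]add2n subnDl. Qed.

Section Transvectants.
Variable F : fieldType.
Implicit Types (p q : {mpoly F[2]}).

Fixpoint transvectant i p q : {mpoly F[2]} :=
  if i is i'.+1 then
    transvectant i' p^`M(ord0) q^`M(ord_max)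
    - transvectant i' p^`M(ord_max) q^`M(ord0)
  else p * q.

Lemma transvectant_linl i q : linear (transvectant i ^~ q).
Proof.
elim: i q => [|i IHi] q a p1 p2 /=; first by rewrite mulrDl scalerAl.
rewrite !mderivD !mderivZ !IHi.
by rewrite scalerBr opprD addrACA.
Qed.

Lemma transvectant_linr i p : linear (transvectant i p).
Proof.
elim: i p => [|i IHi] p a q1 q2 /=; first by rewrite mulrDr scalerAr.
by rewrite !mderivD !mderivZ !IHi scalerBr opprD addrACA.
Qed.

HB.instance Definition _ i p := GRing.isLinear.Build F {mpoly F[2]} {mpoly F[2]} _
  (transvectant i p) (transvectant_linr i p).

Lemma transvectantC i p q : transvectant i q p = (-1) ^+ i *: transvectant i p q.
Proof.
elim: i p q => [|i IHi] p q /=; first by rewrite scale1r mulrC.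
rewrite ![transvectant i q^`M(_) _]IHi -scalerBr exprS mulN1r scaleNr.
by rewrite -scalerN opprB.
Qed.

(** Truncated subtraction is harmless: once [i] exceeds [m] or [n] the transvectant is 0, which is
    homogeneous of every degree. *)
Lemma transvectant_homog i m n p q :
    p \is m.-homog -> q \is n.-homog ->
  transvectant i p q \is (m + n - 2 * i).-homog.
Proof.
have t0l j r : transvectant j 0 r = 0.
  by have /(_ (-1) 0 0) := transvectant_linl j r; rewrite scaler0 addr0 scaleN1r addNr.
elim: i m n p q => [|i IHi] m n p q hp hq.
  by rewrite muln0 subn0; apply: dhomogM.
case: m hp => [|m] hp.
  by rewrite /= ![p^`M(_)]mderiv_homog0 // !t0l subrr dhomog0.
case: n hq => [|n] hq.
  by rewrite /= ![q^`M(_)]mderiv_homog0 // !linear0 addr0 dhomog0.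
rewrite subn_double_addSS.
have hp' j : p^`M(j) \is m.-homog := mderiv_homog j hp.
have hq' j : q^`M(j) \is n.-homog := mderiv_homog j hq.
by apply: rpredB; apply: IHi.
Qed.

Lemma transvectant_linsubst i (A : GL 2 F) p q :
  transvectant i (linsubst A p) (linsubst A q) =
  \det A ^+ i *: linsubst A (transvectant i p q).
Proof.
elim: i p q => [|i IHi] p q /=; first by rewrite scale1r rmorphM.
rewrite !mderiv_linsubst !big_ord2 /=.
rewrite (bilinear_det (transvectant_linl i) (transvectant_linr i)).
by rewrite !IHi -scalerBr -[linsubst A _ - _]raddfB scalerA det_mx2 exprS.
Qed.

End Transvectants.

(** * Coefficients of binary forms *)

Section Dehomogenization.
Variable F : fieldType.
Implicit Types (p q : {mpoly F[2]}) (u : 'X_{1..2}).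

Definition deh_var (i : 'I_2) : {poly F} := if i == ord0 then 'X else 1.

(* p |-> p(X, 1) *)
Definition deh p : {poly F} := mmap (@polyC F) deh_var p.

Lemma deh_linear : linear deh.
Proof. by move=> a p q; rewrite /deh mmapD mmapZ mul_polyC. Qed.
HB.instance Definition _ :=
  GRing.isLinear.Build F {mpoly F[2]} {poly F} _ deh deh_linear.

Lemma deh_multiplicative : multiplicative deh.
Proof. exact: mmap_is_multiplicative. Qed.
HB.instance Definition _ :=
  GRing.isMultiplicative.Build {mpoly F[2]} {poly F} deh deh_multiplicative.

Lemma dehX u : deh 'X_[u] = 'X^(u ord0).
Proof. by rewrite /deh mmapX /mmap1 big_ord2 /deh_var /= expr1n mulr1. Qed.

Lemma mdeg2 u : mdeg u = (u ord0 + u ord_max)%N.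
Proof. by rewrite mdegE big_ord2. Qed.

Lemma homog_ind m (P : {mpoly F[2]} -> Prop) :
    P 0 -> (forall a p q, P p -> P q -> P (a *: p + q)) ->
    (forall u, mdeg u = m -> P 'X_[u]) ->
  forall p, p \is m.-homog -> P p.
Proof.
move=> P0 PL PX p /dhomogP hp; rewrite [p]mpolyE big_seq.
apply: big_rec => // u q up Pq; apply: PL => //; apply: PX; exact: hp.
Qed.

Lemma deh_mderiv0 p : deh p^`M(ord0) = (deh p)^`().
Proof.
elim/mpolyind: p => [|a u p _ _ IHp]; first by rewrite !raddf0.
rewrite mderivD mderivZ [deh (_ + p)]linearP derivD derivZ -IHp.
rewrite mderivX linearP; congr (_ *: _ + _).
rewrite linearZ /= !dehX derivXn mnmBE mnm1E eqxx subn1.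
by rewrite scaler_nat.
Qed.

(** Euler's identity X f_X + Y f_Y = m f, evaluated at Y = 1. *)
Lemma deh_mderiv1 m p : p \is m.-homog ->
  deh p^`M(ord_max) = m%:R *: deh p - 'X * (deh p)^`().
Proof.
move: p; apply: homog_ind => [|a p q IHp IHq|u um].
- by rewrite mderiv0 ![deh 0]raddf0 deriv0 scaler0 mulr0 subr0.
- rewrite mderivD mderivZ ![deh (_ + _)]linearP /= derivD derivZ IHp IHq.
  rewrite mulrDr scalerBr scalerDr !scalerA opprD addrACA.
  by rewrite [a * _]mulrC scalerAr.
rewrite mderivX linearZ /= !dehX derivXn mnmBE mnm1E subn0 -um mdeg2.
rewrite mulrnAr natrD scalerDl !scaler_nat.
case: (u ord0) => [|k]; first by rewrite mulr0n !add0r subr0.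
by rewrite -exprS addrC addKr.
Qed.

Definition mnm2 (a b : nat) : 'X_{1..2} := [multinom if i == ord0 then a else b | i < 2].

Lemma mnm2E u : u = mnm2 (u ord0) (u ord_max).
Proof.
apply/mnmP=> i; rewrite mnmE; case: eqVneq => [->//|].
by case: i => -[|[]] // lti _; congr (u _); apply: val_inj.
Qed.

Lemma deh_mnm2 a b : deh 'X_[mnm2 a b] = 'X^a.
Proof. by rewrite dehX mnmE eqxx. Qed.

Lemma hmon_subproof m (a : 'I_m.+1) : 'X_[mnm2 a (m - a)] \is [in F[2], m.-homog].
Proof. by rewrite dhomogX /= mdeg2 !mnmE /= subnKC // -ltnS. Qed.
Definition hmon m (a : 'I_m.+1) : dhomog 2 F m := DHomog (hmon_subproof a).

(** The degree fixes the exponent of Y, so nothing is lost by setting Y = 1. *)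
Lemma homog_deh m p : p \is m.-homog ->
  p = \sum_(a < m.+1) (deh p)`_a *: 'X_[mnm2 a (m - a)].
Proof.
move: p; apply: homog_ind => [|b p q {1}-> {1}->|u um].
- by rewrite raddf0 big1 // => a _; rewrite coef0 scale0r.
- rewrite scaler_sumr -big_split; apply: eq_bigr => a _ /=.
  by rewrite [deh (_ + _)]linearP coefD coefZ scalerDl scalerA.
have lt_um : (u ord0 < m.+1)%N by rewrite -um mdeg2 ltnS leq_addr.
rewrite (bigD1 (Ordinal lt_um)) //= big1 => [|a au].
  by rewrite dehX coefXn eqxx scale1r addr0 /= -um mdeg2 addKn -mnm2E.
rewrite dehX coefXn; have /negPf-> : a != u ord0 :> nat by [].
by rewrite scale0r.
Qed.

Lemma size_deh m p : p \is m.-homog -> (size (deh p) <= m.+1)%N.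
Proof.
move: p; apply: homog_ind => [|b p q IHp IHq|u um].
- by rewrite raddf0 size_poly0.
- rewrite [deh (_ + _)]linearP (leq_trans (size_polyD _ _)) // geq_max IHq andbT.
  exact: leq_trans (size_scale_leq _ _) _.
by rewrite dehX size_polyXn ltnS -um mdeg2 leq_addr.
Qed.

Section Coefficients.
Variable m : nat.
Implicit Types v : dhomog 2 F m.

Definition dcoef_map (a : nat) v : F^o := (deh v)`_a.
Lemma dcoef_map_linear a : linear (dcoef_map a).
Proof. by move=> x u v; rewrite /dcoef_map linearP coefD coefZ. Qed.
HB.instance Definition _ a :=
  GRing.isLinear.Build F (dhomog 2 F m) F^o _ (dcoef_map a) (dcoef_map_linear a).
Definition dcoef a : 'Hom(dhomog 2 F m, F^o) := linfun (dcoef_map a).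

Lemma dcoefE a v : dcoef a v = (deh v)`_a.
Proof. by rewrite lfunE. Qed.

Lemma dcoef_sum v : v = \sum_(a < m.+1) dcoef a v *: hmon a.
Proof.
apply: val_inj; rewrite /= raddf_sum [LHS](homog_deh (dhomog_is_dhomog v)).
by apply: eq_bigr => a _; rewrite dcoefE.
Qed.

Lemma dcoef_out a v : (m < a)%N -> dcoef a v = 0.
Proof.
move=> ma; rewrite dcoefE nth_default //.
exact: leq_trans (size_deh (dhomog_is_dhomog v)) ma.
Qed.

Lemma dim_dhomog2 : \dim {:dhomog 2 F m} = m.+1.
Proof. by transitivity 'C(m + 1, m); [exact: dimvf | rewrite addn1 binSn]. Qed.

Definition hderiv_map i v : dhomog 2 F m.-1 :=
  DHomog (mderiv_homog i (dhomog_is_dhomog v)).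
Lemma hderiv_map_linear i : linear (hderiv_map i).
Proof. by move=> x u v; apply: val_inj; rewrite /= linearP. Qed.
HB.instance Definition _ i := GRing.isLinear.Build F (dhomog 2 F m)
  (dhomog 2 F m.-1) _ (hderiv_map i) (hderiv_map_linear i).

End Coefficients.
Arguments hderiv_map {m} i v.
Arguments dcoef {m} a.

Lemma dcoef_hderiv0 m a (v : dhomog 2 F m) :
  dcoef a (hderiv_map ord0 v) = a.+1%:R * dcoef a.+1 v.
Proof. by rewrite !dcoefE deh_mderiv0 coef_deriv mulr_natl. Qed.

(** The difference is taken in F, which makes the formula valid for every [a]; beyond [m] both
    coefficients vanish. *)
Lemma dcoef_hderiv1 m a (v : dhomog 2 F m) :
  dcoef a (hderiv_map ord_max v) = (m%:R - a%:R) * dcoef a v.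
Proof.
rewrite !dcoefE (deh_mderiv1 (dhomog_is_dhomog v)) coefB coefZ coefXM mulrBl.
by case: a => [|a]; rewrite ?mul0r ?coef_deriv ?mulr_natl.
Qed.
End Dehomogenization.
Arguments hderiv_map {F m} i v.
Arguments dcoef {F m} a.

(** * Joint bijectivity of the transvectants *)

Section Kernel.
Variables (F : fieldType) (m n : nat) (c : nat -> nat -> F).
Hypothesis nat_neq0 : forall k : nat, (0 < k <= m + n)%N -> k%:R != 0 :> F.
(** [c a b] models the coefficient of X^a Y^(m-a) (x) X^b Y^(n-b) in a tensor: [c_rec] expresses
    that Omega kills it, [c_sum] that T_0 does. *)
Hypothesis c_out : forall a b, (m < a)%N || (n < b)%N -> c a b = 0.
Hypothesis c_rec : forall a b,
  a.+1%:R * c a.+1 b * (n%:R - b%:R) = (m%:R - a%:R) * c a b.+1 * b.+1%:R.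
Hypothesis c_sum : forall w, \sum_(j < w.+1) c j (w - j) = 0.

(** The binomial coefficient divides [r]!, whose factors are all nonzero in F. *)
Lemma bin_neq0 r k : (k <= r <= m + n)%N -> 'C(r, k)%:R != 0 :> F.
Proof.
have fact_neq0 s : (s <= m + n)%N -> s`!%:R != 0 :> F.
  elim: s => [|s IHs] lesmn; first by rewrite oner_neq0.
  by rewrite factS natrM; apply: mulf_neq0; [apply: nat_neq0 | apply/IHs/ltnW].
move=> /andP[kr /fact_neq0]; rewrite -(bin_fact kr) natrM.
by apply: contraNneq => ->; rewrite mul0r.
Qed.

(* The recurrence makes c a b proportional to 'C(m, a) * 'C(n, b) along each
   antidiagonal a + b = w, and the sum of these products is 'C(m + n, w). *)
Lemma clebsch_gordan_kernel a b : c a b = 0.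
Proof.
have [/c_out//|] := boolP ((m < a)%N || (n < b)%N).
rewrite negb_or -!leqNgt => /andP[am bn].
pose u a b := c a b / ('C(m, a)%:R * 'C(n, b)%:R).
have Bm k : (k <= m)%N -> 'C(m, k)%:R != 0 :> F.
  by move=> km; rewrite bin_neq0 // km leq_addr.
have Bn k : (k <= n)%N -> 'C(n, k)%:R != 0 :> F.
  by move=> kn; rewrite bin_neq0 // kn leq_addl.
have binS r k : (k <= r)%N ->
    k.+1%:R * 'C(r, k.+1)%:R = (r%:R - k%:R) * 'C(r, k)%:R :> F.
  by move=> kr; rewrite -natrM mul_bin_left natrM natrB.
have step a' b' : (a' < m)%N -> (b' < n)%N -> u a'.+1 b' = u a' b'.+1.
  move=> am' bn'; rewrite /u; apply/eqP.
  rewrite eqr_div ?mulf_neq0 ?Bm ?Bn //; try exact: ltnW; apply/eqP.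
  have kn0 k l : (k < l)%N -> (l <= m + n)%N -> k.+1%:R != 0 :> F.
    by move=> kl lmn; rewrite nat_neq0 //= (leq_trans kl).
  (* Multiplying by the nonzero scalars [a'.+1] and [b'.+1] makes [c_rec] and both instances of
     [binS] applicable; the rest is a ring identity modulo these three relations. *)
  apply: (mulfI (kn0 _ _ am' (leq_addr _ _))).
  apply: (mulfI (kn0 _ _ bn' (leq_addl _ _))).
  have := c_rec a' b'; have := binS _ _ (ltnW am'); have := binS _ _ (ltnW bn').
  move: (c _ _) (c _ _) 'C(m, _)%:R 'C(m, _)%:R 'C(n, _)%:R 'C(n, _)%:R.
  move: (_ - _) (_ - _) a'.+1%:R b'.+1%:R => mb nb sa sb x y.
  move=> A1 A B1 B eB eA exy.
  have -> : sb * (sa * (y * (A1 * B))) = sa * y * (sb * B) * A1 by ring.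
  rewrite eB.
  have -> : sa * y * (nb * B1) * A1 = (sa * y * nb) * (A1 * B1) by ring.
  rewrite exy.
  have -> : mb * x * sb * (A1 * B1) = sb * x * B1 * (mb * A1) by ring.
  by rewrite -eA; ring.
have uE k a' b' :
    (a' + k <= m)%N -> (b' + k <= n)%N -> u (a' + k)%N b' = u a' (b' + k)%N.
  elim: k b' => [|k IHk] b'; rewrite ?addn0 // !addnS => am' bn'.
  by rewrite step ?IHk ?addSn // ?(ltnW am') // (leq_trans _ bn') // ltnS leq_addr.
have cE j : (j <= a + b)%N ->
    c j (a + b - j) = u a b * ('C(m, j) * 'C(n, a + b - j))%:R.
  (* Outside the rectangle both sides vanish, the right one through a zero binomial coefficient. *)
  move=> jab; have [out|] := boolP ((m < j)%N || (n < a + b - j)%N).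
    by rewrite c_out //; case/orP: out => /bin_small->; rewrite ?mul0n ?muln0 mulr0.
  rewrite negb_or -!leqNgt => /andP[jm jn].
  rewrite -[LHS](divfK (mulf_neq0 (Bm _ jm) (Bn _ jn))) natrM; congr (_ * _).
  rewrite -/(u j _); have [ja|/ltnW aj] := leqP j a.
    have [k aE] : exists k, a = (j + k)%N by exists (a - j)%N; rewrite subnKC.
    have bE : (a + b - j = b + k)%N by rewrite aE -addnA addKn addnC.
    by rewrite bE in jn *; rewrite [in RHS]aE uE -?aE.
  have [k jE] : exists k, j = (a + k)%N by exists (j - a)%N; rewrite subnKC.
  have bE : (a + b - j + k = b)%N.
    by rewrite jE subnDl subnK // -(leq_add2l a) -jE.
  by rewrite {1}jE uE ?bE -?jE.
have /eqP := c_sum (a + b).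
have -> : \sum_(j < (a + b).+1) c j (a + b - j) = u a b * 'C(m + n, a + b)%:R.
  (* Vandermonde's convolution sums the products along the antidiagonal; its value is nonzero in F,
     so [u a b] must vanish. *)
  rewrite -binomial.Vandermonde natr_sum mulr_sumr; apply: eq_bigr => j _.
  by rewrite cE // -ltnS.
rewrite mulf_eq0 (negPf (bin_neq0 _)) ?leq_add ?leqnn // orbF.
by rewrite mulf_eq0 invr_eq0 mulf_eq0 (negPf (Bm _ am)) (negPf (Bn _ bn)) !orbF => /eqP.
Qed.
End Kernel.

Section TensorTransvectants.
Variables (F : fieldType).
Local Notation V m := (dhomog 2 F m).

Lemma dhomog_linear (U : lmodType F) (m : nat) (f : U -> V m) :
  (forall a u v, mpoly_of_dhomog (f (a *: u + v)) =
     a *: mpoly_of_dhomog (f u) + mpoly_of_dhomog (f v)) -> linear f.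
Proof. by move=> fl a u v; apply: val_inj; rewrite /= fl. Qed.

Section Fixed.
Variables m n : nat.
Implicit Types (v : V m) (w : V n) (t : tensor (V m) (V n)).

Definition ttrans i : 'Hom(tensor (V m) (V n), V (m + n - 2 * i)) :=
  tens_lift (fun v w => DHomog (transvectant_homog i (dhomog_is_dhomog v)
                                                  (dhomog_is_dhomog w))).

Lemma ttransE i v w : mpoly_of_dhomog (ttrans i (tens v w)) = transvectant i v w.
Proof.
rewrite /ttrans tens_liftE // => [w'|v']; apply: dhomog_linear => a x y /=.
  exact: transvectant_linl.
exact: transvectant_linr.
Qed.

(** Cayley's Omega operator. If [m] or [n] is 0, its predecessor is again 0 and the map is zero
    ([tomega0]). *)
Definition tomega : 'Hom(tensor (V m) (V n), tensor (V m.-1) (V n.-1)) :=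
  tens_lift (fun v w => tens (hderiv_map ord0 v) (hderiv_map ord_max w)
                      - tens (hderiv_map ord_max v) (hderiv_map ord0 w)).

Lemma tomegaE v w :
  tomega (tens v w) = tens (hderiv_map ord0 v) (hderiv_map ord_max w)
                      - tens (hderiv_map ord_max v) (hderiv_map ord0 w).
Proof.
rewrite /tomega tens_liftE // => [w'|v'] a x y; rewrite !linearP.
  by rewrite !tensDl !tensZl scalerBr opprD addrACA.
by rewrite !tensDr !tensZr scalerBr opprD addrACA.
Qed.

Definition tcoef a b : 'Hom(tensor (V m) (V n), F^o) :=
  tens_lift (fun v w => dcoef a v * dcoef b w : F^o).

Lemma tcoefE a b v w : tcoef a b (tens v w) = dcoef a v * dcoef b w.
Proof.
rewrite /tcoef tens_liftE // => [w'|v'] x s u; rewrite linearP.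
  by rewrite mulrDl scalerAl.
by rewrite mulrDr scalerAr.
Qed.

Lemma tcoef_sum t :
  t = \sum_(a < m.+1) \sum_(b < n.+1) tcoef a b t *: tens (hmon F a) (hmon F b).
Proof.
elim/tens_ind: t => [v w|x s t {1}-> {1}->].
  rewrite {1}[v]dcoef_sum tens_suml; apply: eq_bigr => a _.
  rewrite {1}[w]dcoef_sum tens_sumr; apply: eq_bigr => b _.
  by rewrite tcoefE tensZl tensZr scalerA.
rewrite scaler_sumr -big_split; apply: eq_bigr => a _.
rewrite scaler_sumr -big_split; apply: eq_bigr => b _.
by rewrite linearP /= scalerDl scalerA.
Qed.

Lemma tcoef_out a b t : (m < a)%N || (n < b)%N -> tcoef a b t = 0.
Proof.
move=> out; elim/tens_ind: t => [v w|x s t s0 t0].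
  by rewrite tcoefE; case/orP: out => /dcoef_out->; rewrite ?mul0r ?mulr0.
by rewrite linearP /= s0 t0 scaler0 addr0.
Qed.

(** T_0 multiplies the two factors, so its coefficients are sums along antidiagonals; this supplies
    [c_sum]. *)
Lemma deh_ttrans0 t k :
  (deh (ttrans 0 t))`_k = \sum_(j < k.+1) tcoef j (k - j) t.
Proof.
elim/tens_ind: t => [v w|x s t IHs IHt].
  rewrite ttransE /= rmorphM coefM; apply: eq_bigr => j _.
  by rewrite tcoefE !dcoefE.
rewrite linearP /= linearP coefD coefZ IHs IHt mulr_sumr -big_split.
by apply: eq_bigr => j _; rewrite linearP.
Qed.
End Fixed.
Arguments ttrans {m n} i.
Arguments tomega {m n}.
Arguments tcoef {m n} a b.

(** An equality of underlying polynomials, because the two degrees are equal but not convertible. *)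
Lemma ttransS m n i (t : tensor (V m.+1) (V n.+1)) :
  mpoly_of_dhomog (ttrans i.+1 t) = ttrans i (tomega t).
Proof.
elim/tens_ind: t => [v w|x s t IHs IHt].
  by rewrite tomegaE linearB /= !ttransE.
by rewrite !linearP /= IHs IHt.
Qed.

Lemma tcoef_tomega m n a b (t : tensor (V m) (V n)) :
  tcoef a b (tomega t) =
    a.+1%:R * tcoef a.+1 b t * (n%:R - b%:R)
    - (m%:R - a%:R) * tcoef a b.+1 t * b.+1%:R.
Proof.
elim/tens_ind: t => [v w|x s t IHs IHt].
  rewrite tomegaE linearB /= !tcoefE !dcoef_hderiv0 !dcoef_hderiv1.
  ring.
rewrite !linearP /= IHs IHt /GRing.scale /=; ring.
Qed.

Lemma clebsch_gordan_inj0 m n (t : tensor (V m) (V n)) :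
    (forall k : nat, (0 < k <= m + n)%N -> k%:R != 0 :> F) ->
  ttrans 0 t = 0 -> tomega t = 0 -> t = 0.
Proof.
move=> nat_neq0 t0 omega0; rewrite [t]tcoef_sum big1 // => a _.
rewrite big1 // => b _.
rewrite (@clebsch_gordan_kernel F m n (fun a b => tcoef a b t)) ?scale0r //.
- by move=> a' b'; apply: tcoef_out.
- by move=> a' b'; apply/eqP; rewrite -subr_eq0 -tcoef_tomega omega0 linear0.
- by move=> w; rewrite -deh_ttrans0 t0 [deh _]linear0 coef0.
Qed.

Lemma tomega0 m n (t : tensor (V m) (V n)) : minn m n = 0%N -> tomega t = 0.
Proof.
move=> mn0; elim/tens_ind: t => [v w|a s t s0 t0]; last first.
  by rewrite linearP /= s0 t0 scaler0 addr0.
have d0 k i (u : V k) : k = 0%N -> hderiv_map i u = 0.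
  by case: k u => // u _; apply/val_inj/mderiv_homog0/dhomog_is_dhomog.
rewrite tomegaE; case: (leqP m n) mn0 => _ k0.
  by rewrite !(d0 m) // !tens0l subr0.
by rewrite !(d0 n) // !tens0r subr0.
Qed.

Lemma clebsch_gordan_inj m n (t : tensor (V m) (V n)) :
    (forall k : nat, (0 < k <= m + n)%N -> k%:R != 0 :> F) ->
  (forall i, (i <= minn m n)%N -> ttrans i t = 0) -> t = 0.
Proof.
elim: m n t => [|m IHm] [|n] t nat_neq0 t0;
  (* If [m] or [n] is 0, Omega vanishes and T_0 alone is injective. *)
  try by apply: clebsch_gordan_inj0; rewrite ?t0 ?tomega0 ?minn0 ?min0n.
apply: clebsch_gordan_inj0 => //; first exact: t0.
apply: (IHm n) => [k /andP[k0 kmn]|i imn].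
  by rewrite nat_neq0 // k0 (leq_trans kmn) // leq_add.
by apply: val_inj; rewrite /= -ttransS t0 // minnSS.
Qed.

(** The targets are plain polynomials with a homogeneity condition, so that the induction can shift
    the family [w] without transporting between degrees. *)
Lemma clebsch_gordan_surj m n (w : nat -> {mpoly F[2]}) :
    (forall k : nat, (0 < k <= m + n)%N -> k%:R != 0 :> F) ->
    (forall i, (i <= minn m n)%N -> w i \is (m + n - 2 * i).-homog) ->
  exists t : tensor (V m) (V n),
    forall i, (i <= minn m n)%N -> mpoly_of_dhomog (ttrans i t) = w i.
Proof.
have hone : (1 : {mpoly F[2]}) \is 0.-homog := dhomog1 _ _.
elim: m n w => [|m IHm] n w nat_neq0 hw.
  have hw0 : w 0 \is n.-homog by have := hw 0%N isT; rewrite muln0 subn0.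
  exists (tens (DHomog hone) (DHomog hw0)) => i; rewrite min0n leqn0 => /eqP->.
  by rewrite ttransE /= mul1r.
case: n nat_neq0 hw => [|n] nat_neq0 hw.
  have hw0 : w 0 \is m.+1.-homog.
    by have := hw 0%N isT; rewrite muln0 subn0 addn0.
  exists (tens (DHomog hw0) (DHomog hone)) => i; rewrite minn0 leqn0 => /eqP->.
  by rewrite ttransE /= mulr1.
have [k kmn|i imn|t tP] := IHm n (w \o succn).
- by case/andP: kmn => k0 kmn; rewrite nat_neq0 // k0 (leq_trans kmn) // leq_add.
- by rewrite /= -subn_double_addSS hw // minnSS.
have w0 : w 0 \is (m.+1 + n.+1 - 2 * 0).-homog by apply: hw.
pose f := lfun_pair (@ttrans m.+1 n.+1 0) tomega.
have f_inj s : f s = 0 -> s = 0.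
  by rewrite lfun_pairE => -[]; apply: clebsch_gordan_inj0.
(* The count is (m+2)(n+2) = (m+n+3) + (m+1)(n+1), so the injective map (T_0, Omega) is onto. *)
have dimf : \dim {:tensor (V m.+1) (V n.+1)} =
    \dim {:(V (m.+1 + n.+1 - 2 * 0) * tensor (V m) (V n))%type}.
  rewrite dim_pair !dim_tensor !dim_dhomog2 muln0 subn0.
  ring.
have [s] := lfun_inj_dim_surj f_inj dimf (DHomog w0, t).
rewrite lfun_pairE => -[s0 st]; exists s => -[|i] imn; first by rewrite s0.
by rewrite ttransS st tP // -ltnS -minnSS.
Qed.

End TensorTransvectants.
Arguments ttrans {F m n} i.
Arguments tomega {F m n}.

(** * Irreducibility *)

Section Irreducibility.
Variable F : fieldType.

Lemma coef_comp_polyXD1 (q : {poly F}) d a : (size q <= d)%N ->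
  (q \Po ('X + 1))`_a = \sum_(i < d) q`_i * 'C(i, a)%:R.
Proof.
move=> qd; have coefXD1 i : (('X + 1 : {poly F}) ^+ i)`_a = 'C(i, a)%:R.
  rewrite exprD1n coef_sum; have [ai|ia] := ltnP a i.+1.
    rewrite (bigD1 (Ordinal ai)) //= coefMn coefXn eqxx big1 ?addr0 // => j ja.
    by rewrite coefMn coefXn eq_sym -[_ == _]/(j == Ordinal ai) (negPf ja) mul0rn.
  rewrite bin_small // big1 // => j _; rewrite coefMn coefXn gtn_eqF ?mul0rn //.
  exact: leq_trans ia.
rewrite coef_comp_poly (big_ord_widen d (fun i => q`_i * (('X + 1) ^+ i)`_a)) //.
rewrite big_mkcond; apply: eq_bigr => i _; rewrite coefXD1; case: ltnP => // qi.
by rewrite nth_default ?mul0r.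
Qed.

(** The leading terms cancel, and 'C(d, d-1) = d gives the next coefficient. The second clause is
    void for [d = 0]. *)
Lemma coef_difference (q : {poly F}) d : (size q <= d.+1)%N ->
  (size (q \Po ('X + 1) - q)%R <= d)%N /\
  forall e, d = e.+1 -> (q \Po ('X + 1) - q)`_e = d%:R * q`_d.
Proof.
move=> qd; split=> [|e de].
  apply/leq_sizeP=> a; rewrite coefB (coef_comp_polyXD1 _ qd) big_ord_recr /=.
  move=> da; rewrite big1 ?add0r => [|i _]; last first.
    by rewrite bin_small ?mulr0 // (leq_trans _ da).
  move: da; rewrite leq_eqVlt => /predU1P[<-|da]; first by rewrite binn mulr1 subrr.
  by rewrite bin_small // mulr0 nth_default ?subrr // (leq_trans qd).
subst d; rewrite coefB (coef_comp_polyXD1 _ qd) !big_ord_recr /= big1 => [|i _].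
  by rewrite add0r binn mulr1 addrAC subrr add0r binSn mulrC.
by rewrite bin_small ?mulr0.
Qed.

(** As a substitution the shear fixes Y and sends X to X + Y. *)
Definition shear_mx : 'M[F]_2 := \matrix_(i, j) (i <= j)%N%:R.
Definition swap_mx : 'M[F]_2 := \matrix_(i, j) (i != j)%:R.

Lemma shear_unit : shear_mx \in unitmx.
Proof. by rewrite unitmxE det_mx2 !mxE /= mulr1 mulr0 subr0 unitr1. Qed.
Lemma swap_unit : swap_mx \in unitmx.
Proof. by rewrite unitmxE det_mx2 !mxE /= mulr1 mul0r sub0r unitrN1. Qed.
Definition shear := MkGL shear_unit.
Definition swap := MkGL swap_unit.

Lemma linsubstX (A : GL 2 F) (u : 'X_{1..2}) :
  linsubst A 'X_[u] =
    (A ord0 ord0 *: 'X_ord0 + A ord0 ord_max *: 'X_ord_max) ^+ u ord0 *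
    (A ord_max ord0 *: 'X_ord0 + A ord_max ord_max *: 'X_ord_max) ^+ u ord_max.
Proof.
by rewrite /linsubst comp_mpolyX big_ord2 !tnth_mktuple !big_ord2 /= !mul_mpolyC.
Qed.

Lemma deh_shear (p : {mpoly F[2]}) : deh (linsubst shear p) = deh p \Po ('X + 1).
Proof.
elim/mpolyind: p => [|a u p _ _ IHp].
  by rewrite [linsubst _ 0]raddf0 [deh 0]raddf0 comp_poly0.
rewrite [linsubst _ (_ + p)]linearP ![deh (_ + _)]linearP /=.
rewrite comp_polyD comp_polyZ -IHp dehX comp_Xn_poly; congr (_ *: _ + _).
rewrite linsubstX !mxE /= !scale1r scale0r add0r rmorphM !rmorphXn rmorphD /=.
by rewrite !dehX !mnm1E /= expr1 expr0 expr1n mulr1.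
Qed.

Lemma linsubst_swap a b :
  linsubst swap 'X_[mnm2 a b] = 'X_[mnm2 b a].
Proof.
rewrite linsubstX !mxE /= !scale1r !scale0r addr0 add0r mulrC !mpolyXn -mpolyXD.
congr 'X_[_]; apply/mnmP=> -[[|[|//]] lti]; rewrite mnmDE !mulmnE !mnm1E !mnmE /=.
  by rewrite mul1n mul0n addn0.
by rewrite mul1n mul0n.
Qed.

Variable k : nat.
Hypothesis nat_neq0 : forall j : nat, (0 < j <= k)%N -> j%:R != 0 :> F.
Variable U : {vspace Vhom F k}.
Hypothesis U_inv : ginvariant U.
Implicit Types v : dhomog 2 F k.

Lemma deh_inj v : deh v = 0 -> v = 0.
Proof.
move=> v0; apply: val_inj; rewrite [LHS](homog_deh (dhomog_is_dhomog v)) /=.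
by rewrite big1 // => a _; rewrite v0 coef0 scale0r.
Qed.

Lemma mem_linsubst A v : v \in U -> Vhom_map A v \in U.
Proof.
move=> vU; have := subvP (U_inv A) (Vhom_map A v); apply.
by have := memv_img (gact (Vhom F k) A) vU; rewrite lfunE.
Qed.

Lemma mem_difference v d : v \in U -> (size (deh v) <= d.+2)%N ->
  exists2 w : dhomog 2 F k, w \in U &
    (size (deh w) <= d.+1)%N /\ (deh w)`_d = d.+1%:R * (deh v)`_d.+1.
Proof.
move=> vU vd; exists (Vhom_map shear v - v); first by rewrite rpredB ?mem_linsubst.
have [? /(_ d erefl)] := coef_difference vd.
by rewrite /= linearB /= deh_shear.
Qed.

Lemma coef_deh_neq0 v d : (deh v)`_d != 0 -> (d <= k)%N.
Proof.
by apply: contraR; rewrite -ltnNge -dcoefE => /dcoef_out->.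
Qed.

(** Differences lower the X-degree one by one down to a nonzero multiple of Y^k. *)
Lemma Y_pow_mem v d : v \in U -> v != 0 -> (size (deh v) <= d.+1)%N ->
  hmon F (ord0 : 'I_k.+1) \in U.
Proof.
elim: d v => [|d IHd] v vU v0 vd.
  have vE : v = (deh v)`_0 *: hmon F (ord0 : 'I_k.+1).
    rewrite {1}[v]dcoef_sum big_ord_recl big1 ?addr0 ?dcoefE // => a _.
    by rewrite dcoefE nth_default ?scale0r // (leq_trans vd).
  move: vU; rewrite vE rpredZeq => /orP[/eqP c0|//].
  by rewrite vE c0 scale0r eqxx in v0.
have [c0|c0] := eqVneq (deh v)`_d.+1 0.
  apply: (IHd v) => //; apply/leq_sizeP=> j; rewrite leq_eqVlt => /predU1P[<- //|dj].
  by rewrite nth_default // (leq_trans vd).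
have dk := coef_deh_neq0 c0.
have [w wU [wd cw]] := mem_difference vU vd; apply: (IHd w) => //.
(* The difference is nonzero: its leading coefficient is that of [v] times [d.+1], and [d.+1 <= k]
   is nonzero in F. *)
apply: contraNneq c0 => w0; move: cw; rewrite w0 [deh _]raddf0 coef0.
by move/esym/eqP; rewrite mulf_eq0 (negPf (nat_neq0 _)).
Qed.

(** The swap turns Y^k into X^k, and [k - d] successive differences bring the X-degree down to
    exactly [d]. *)
Lemma mem_of_degree d : (d <= k)%N -> hmon F (ord0 : 'I_k.+1) \in U ->
  exists2 v : dhomog 2 F k, v \in U &
    (size (deh v) <= d.+1)%N /\ (deh v)`_d != 0.
Proof.
move=> dk y_in; rewrite -(subKn dk); elim: (k - d)%N (leq_subr d k) => [|j IHj] jk.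
  exists (Vhom_map swap (hmon F ord0)); first exact: mem_linsubst.
  by rewrite /= linsubst_swap !subn0 deh_mnm2 size_polyXn coefXn eqxx oner_neq0.
have [v vU [vd cv]] := IHj (ltnW jk).
have kj : (k - j = (k - j.+1).+1)%N by rewrite subnSK.
rewrite kj in vd cv; have [w wU [wd cw]] := mem_difference vU vd.
exists w => //; split=> //; rewrite cw mulf_neq0 // nat_neq0 //=.
by rewrite -kj leq_subr.
Qed.

(** Elimination by degree: a multiple of an element of [U] of X-degree [d] removes the top term of
    [v]. *)
Lemma mem_of_Y_pow d v :
  hmon F (ord0 : 'I_k.+1) \in U -> (size (deh v) <= d)%N -> v \in U.
Proof.
move=> y_in; elim: d v => [|d IHd] v vd.
  rewrite (deh_inj (v := v)) ?mem0v //.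
  by apply/eqP; rewrite -size_poly_eq0 -leqn0.
have [dk|kd] := leqP d k; last first.
  by apply: IHd; apply: leq_trans (size_deh (dhomog_is_dhomog v)) kd.
have [u uU [ud cu]] := mem_of_degree dk y_in.
pose c := (deh v)`_d / (deh u)`_d.
rewrite -[v](subrK (c *: u)) rpredD ?rpredZ // IHd //.
apply/leq_sizeP=> j; rewrite /= linearB linearZ /= coefB coefZ leq_eqVlt.
case/predU1P=> [<-|dj]; first by rewrite divfK ?subrr.
by rewrite !nth_default ?mulr0 ?subr0 // (leq_trans _ dj).
Qed.

End Irreducibility.

Lemma Vhom_irreducible (F : fieldType) k :
  (forall j : nat, (0 < j <= k)%N -> j%:R != 0 :> F) -> girreducible (Vhom F k).
Proof.
move=> nat_neq0; split=> [V0|U U_inv].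
  have : hmon F (ord0 : 'I_k.+1) \in (0%VS : {vspace Vhom F k}).
    by rewrite -V0 memvf.
  rewrite memv0 => /eqP/(congr1 (fun v : dhomog 2 F k => deh v)).
  rewrite deh_mnm2 [deh _]raddf0 => /eqP; rewrite expr0 oner_eq0 //.
have [->|U0] := eqVneq U 0%VS; [by left | right].
apply/vspaceP=> v; rewrite memvf; apply: (mem_of_Y_pow nat_neq0 U_inv _ (leqnn _)).
apply: (Y_pow_mem nat_neq0 U_inv (memv_pick U) _ (size_deh (dhomog_is_dhomog _))).
by rewrite vpick0.
Qed.

(** * The decompositions *)

Section Decomposition.
Variable F : fieldType.

Lemma mpoly_of_dhomog_inj k : injective (@mpoly_of_dhomog 2 F k).
Proof. exact: val_inj. Qed.

Lemma VhomE k (A : GL 2 F) (v : dhomog 2 F k) : gact (Vhom F k) A v = Vhom_map A v.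
Proof. exact: lfunE. Qed.

Lemma oppr_fixed (V : lmodType F) (v : V) : 2%:R != 0 :> F -> v = - v -> v = 0.
Proof.
move=> two_neq0 /eqP; rewrite -addr_eq0 -mulr2n -scaler_nat scaler_eq0.
by rewrite (negPf two_neq0) => /eqP.
Qed.

(** Both alternatives on the characteristic enter the proof only through the nonvanishing of 1, ...,
    [N] in F. *)
Lemma pchar_natf_neq0 N :
    [pchar F] =i pred0 \/ (exists2 p, p \in [pchar F] & (N < p)%N) ->
  forall k : nat, (0 < k <= N)%N -> k%:R != 0 :> F.
Proof.
move=> + k /andP[k0 kN]; case=> [/pcharf0P->|[p pF Np]]; first by rewrite -lt0n.
by rewrite -(dvdn_pcharf pF) gtnNdvd // (leq_ltn_trans kN).
Qed.

Lemma det_GL_neq0 (A : GL 2 F) : \det A != 0.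
Proof. by rewrite -unitfE -unitmxE GLmx_unit. Qed.

Lemma twist_irreducible i k :
    (forall j : nat, (0 < j <= k)%N -> j%:R != 0 :> F) ->
  girreducible (gtens (gtpow (Vdet F) i) (Vhom F k)).
Proof.
move=> nat_neq0; have [d dP] := gline_det F i.
apply: (girreducible_twist (gtwist_bij _ dP) _ (gtwist_act dP)).
  by move=> A; rewrite expf_neq0 ?det_GL_neq0.
exact: Vhom_irreducible.
Qed.

Section Maps.
Variables m n : nat.
Local Notation W i := (gtens (gtpow (Vdet F) i) (Vhom F (m + n - 2 * i))).

(** T_i is equivariant only up to det^i; tensoring with the basis vector of the [i]-th power of
    [Vdet] absorbs this factor. *)
Definition cg_map i : 'Hom(gtens (Vhom F m) (Vhom F n), W i) :=
  (gtwist (Vhom F (m + n - 2 * i)) (sval (gline_det F i)) \o ttrans i)%VF.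

Lemma ttrans_act i (A : GL 2 F) (t : gtens (Vhom F m) (Vhom F n)) :
  ttrans i (gact (gtens (Vhom F m) (Vhom F n)) A t) =
  \det A ^+ i *: gact (Vhom F (m + n - 2 * i)) A (ttrans i t).
Proof.
elim/tens_ind: t => [v w|a s t IHs IHt].
  rewrite [gact _ A _]tens_mapE; apply: mpoly_of_dhomog_inj.
  rewrite [gact (Vhom F m) _ v]VhomE [gact (Vhom F n) _ w]VhomE.
  rewrite [gact (Vhom F (m + n - 2 * i)) _ _]VhomE.
  by rewrite linearZ /= !ttransE transvectant_linsubst.
rewrite linearP /= linearP /= [in RHS]linearP /= [in RHS]linearP /=.
by rewrite IHs IHt scalerDr !scalerA mulrC.
Qed.

Lemma cg_map_act i (A : GL 2 F) t :
  cg_map i (gact (gtens (Vhom F m) (Vhom F n)) A t) = gact (W i) A (cg_map i t).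
Proof.
by rewrite !comp_lfunE ttrans_act linearZ (gtwist_act (svalP (gline_det F i))).
Qed.

Lemma cg_map_eq0 i t : cg_map i t = 0 <-> ttrans i t = 0.
Proof.
rewrite comp_lfunE; split=> [|->]; last by rewrite linear0.
have /bij_inj inj := gtwist_bij (Vhom F (m + n - 2 * i)) (svalP (gline_det F i)).
by move=> t0; apply: inj; rewrite [LHS]t0 linear0.
Qed.

Hypothesis nat_neq0 : forall k : nat, (0 < k <= m + n)%N -> k%:R != 0 :> F.

Lemma cg_map_inj t : (forall i, (i <= minn m n)%N -> cg_map i t = 0) -> t = 0.
Proof.
move=> t0; apply: clebsch_gordan_inj => // i imn.
exact/cg_map_eq0/t0.
Qed.

Lemma cg_map_surj (w : forall i, W i) :
  exists t, forall i, (i <= minn m n)%N -> cg_map i t = w i.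
Proof.
pose tw i := gtwist (Vhom F (m + n - 2 * i)) (sval (gline_det F i)).
pose w' i : dhomog 2 F (m + n - 2 * i) := ((tw i)^-1)%VF (w i).
have [i imn|t tP] := clebsch_gordan_surj (w := fun i => mpoly_of_dhomog (w' i)) nat_neq0.
  exact: dhomog_is_dhomog.
exists t => i imn; rewrite comp_lfunE.
have -> : ttrans i t = w' i by apply: val_inj; apply: tP.
have [h hK _] := gtwist_bij (Vhom F (m + n - 2 * i)) (svalP (gline_det F i)).
rewrite /w' limg_lfunVK //.
have [h' _ h'K] := gtwist_bij (Vhom F (m + n - 2 * i)) (svalP (gline_det F i)).
by rewrite -[w i]h'K memv_img ?memvf.
Qed.

Lemma clebsch_gordan :
  gisomorphic (gtens (Vhom F m) (Vhom F n))
    (\big[@gdsum F (GL 2 F)/gzero F (GL 2 F)]_(0 <= i < (minn m n).+1) W i).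
Proof.
apply: (gisomorphic_bigdsum (f := cg_map)).
- exact: iota_uniq.
- by move=> i _; apply: cg_map_act.
- move=> t t0; apply: cg_map_inj => i imn; apply: t0 => //.
  by rewrite mem_index_iota.
move=> w; have [t tP] := cg_map_surj w; exists t => i.
by rewrite mem_index_iota => /tP.
Qed.

End Maps.

Section Squares.
Variable m : nat.
Hypothesis two_neq0 : 2%:R != 0 :> F.
Hypothesis nat_neq0 : forall k : nat, (0 < k <= m + m)%N -> k%:R != 0 :> F.
Local Notation V := (Vhom F m).
Local Notation W i := (gtens (gtpow (Vdet F) i) (Vhom F (m + m - 2 * i))).

Definition tswap : 'End(gtens V V) := tens_lift (fun v w => tens w v).

Lemma tswapE v w : tswap (tens v w) = tens w v.
Proof.
rewrite [LHS]tens_liftE // => [y|x] a s t; first by rewrite tensDr tensZr.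
by rewrite tensDl tensZl.
Qed.

Lemma ttrans_swap i t : ttrans i (tswap t) = (-1) ^+ i *: ttrans i t.
Proof.
elim/tens_ind: t => [v w|a s t IHs IHt].
  rewrite tswapE; apply: mpoly_of_dhomog_inj.
  by rewrite /= !ttransE transvectantC.
by rewrite linearP /= linearP /= IHs IHt linearP /= scalerDr !scalerA mulrC.
Qed.

(** Both squares at once: [e] is the parity of the surviving indices, true for the exterior square
    and false for the symmetric one. Transvectants of parity [e] descend to the quotient. *)
Lemma clebsch_gordan_square (U : {vspace gtens V V}) (invU : ginvariant U)
    (e : bool) (r : seq nat) (P : pred nat) :
    (forall t, t - (-1) ^+ e *: tswap t \in U) ->
    (forall i, odd i = e -> forall t, t \in U -> ttrans i t = 0) ->
    uniq r -> (forall i, P i -> odd i = e) ->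
    (forall i, (i \in r) && P i = (i <= m)%N && (odd i == e)) ->
  gisomorphic (gquo invU) (\big[@gdsum F (GL 2 F)/gzero F (GL 2 F)]_(i <- r | P i) W i).
Proof.
move=> swapU U0 r_uniq Pe rP.
have fU0 i : P i -> forall t, t \in U -> cg_map m m i t = 0.
  by move=> /Pe ei t tU; apply/cg_map_eq0; apply: (U0 i).
pose f i := gquo_lift invU (cg_map m m i).
apply: (@gisomorphic_bigdsum _ _ (gquo invU) (fun i => W i) r P f r_uniq).
- by move=> i Pi A x; apply: gquo_lift_act; [apply: cg_map_act | apply: fU0].
- move=> x x0; rewrite -[x]gquo_proj_val; move: (vsval x) (gquo_proj_val x) => t tx.
  apply/eqP; rewrite gquo_proj_ker.
  have tr0 i : (i <= m)%N -> odd i = e -> ttrans i t = 0.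
    move=> im ei; have /andP[ir Pi] : (i \in r) && P i by rewrite rP im ei eqxx.
    by apply/cg_map_eq0; rewrite -(gquo_liftE invU) ?tx ?x0 //; apply: fU0.
  (* All T_i kill this tensor: those of parity [e] kill [t], and for the others the factor 1 +
     (-1)^(e+i) is 0. Hence 2t equals t - (-1)^e [tswap t], which lies in [U]. *)
  have /eqP : t + (-1) ^+ e *: tswap t = 0.
    apply: (clebsch_gordan_inj nat_neq0) => i; rewrite minnn => im.
    rewrite linearD linearZ /= ttrans_swap scalerA -{1}[ttrans i t]scale1r -scalerDl.
    have [ei|ei] := eqVneq (odd i) e; first by rewrite tr0 ?scaler0.
    rewrite -(signr_odd _ i) -signr_addb.
    have -> : e (+) odd i by rewrite -negb_eqb eq_sym.
    by rewrite expr1 subrr scale0r.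
  rewrite addr_eq0 => /eqP tE.
  have t2 : t - (-1) ^+ e *: tswap t = 2%:R *: t by rewrite -tE scaler_nat.
  have := swapU t; rewrite t2 => /(rpredZ 2%:R^-1).
  by rewrite scalerA mulVf // scale1r.
move=> w; have [t tP] := cg_map_surj nat_neq0 w.
exists (gquo_proj U t) => i ir Pi; rewrite gquo_liftE ?tP ?minnn //; last exact: fU0.
by have := rP i; rewrite ir Pi => /esym/andP[].
Qed.

Lemma exterior_square :
  gisomorphic (gext2 V)
    (\big[@gdsum F (GL 2 F)/gzero F (GL 2 F)]_(1 <= i < m.+1 | odd i) W i).
Proof.
have [/(_ (subvv _)) tt _] := ext_relP (ext_rel V).
apply: (@clebsch_gordan_square _ _ true); rewrite ?iota_uniq //.
- move=> t; rewrite expr1 scaleN1r opprK; elim/tens_ind: t => [v w|a s t IHs IHt].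
    (* Polarization of the square of [v + w]. *)
    have := tt (v + w); rewrite tensDl !tensDr tswapE -addrA.
    by rewrite rpredDl ?tt // addrA rpredDr ?tt.
  by rewrite linearP addrACA -scalerDr rpredD ?rpredZ.
- move=> i oi t tU; suff /subvP/(_ t tU) : (ext_rel V <= lker (ttrans i))%VS.
    by rewrite memv_ker => /eqP.
  apply/ext_relP=> v; rewrite memv_ker.
  (* For odd [i] the value at [tens v v] equals its own opposite, hence is 0 as 2 is invertible. *)
  have := ttrans_swap i (tens v v); rewrite tswapE -signr_odd oi scaleN1r.
  by move/(oppr_fixed two_neq0)/eqP.
(* At [i = 0] both sides are false: 0 lies outside the range and is even. *)
- move=> i; rewrite mem_index_iota ltnS eqb_id; case: i => [|i]; rewrite ?andbF //.
Qed.

Lemma symmetric_square :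
  gisomorphic (gsym2 V)
    (\big[@gdsum F (GL 2 F)/gzero F (GL 2 F)]_(0 <= i < m.+1 | ~~ odd i) W i).
Proof.
have [/(_ (subvv _)) tt _] := sym_relP (sym_rel V).
apply: (@clebsch_gordan_square _ _ false); rewrite ?iota_uniq //.
- move=> t; rewrite expr0 scale1r; elim/tens_ind: t => [v w|a s t IHs IHt].
    by rewrite tswapE.
  by rewrite linearP opprD addrACA -scalerBr rpredD ?rpredZ.
- move=> i oi t tU; suff /subvP/(_ t tU) : (sym_rel V <= lker (ttrans i))%VS.
    by rewrite memv_ker => /eqP.
  apply/sym_relP=> v w; rewrite memv_ker linearB /= -tswapE ttrans_swap.
  by rewrite -signr_odd oi scale1r subrr.
- by move=> i /negPf.
- by move=> i; rewrite mem_index_iota ltnS eqbF_neg.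
Qed.

End Squares.
End Decomposition.

Local Close Scope ring_scope.

Theorem theorem7p1 (F : fieldType) (char_neq2 : 2 \notin [pchar F]%R)
    (m n : nat) :
  (([pchar F]%R =i pred0 \/ exists2 p, p \in [pchar F]%R & m + n < p) ->
     gisomorphic (gtens (Vhom F m) (Vhom F n))
       (\big[@gdsum F (GL 2 F)/gzero F (GL 2 F)]_(0 <= i < (minn m n).+1)
          gtens (gtpow (Vdet F) i) (Vhom F (m + n - 2 * i)))
     /\ (forall i, i <= minn m n ->
          girreducible (gtens (gtpow (Vdet F) i) (Vhom F (m + n - 2 * i)))))
  /\
  (([pchar F]%R =i pred0 \/ exists2 p, p \in [pchar F]%R & 2 * m < p) ->
     [/\ gisomorphic (gext2 (Vhom F m))
           (\big[@gdsum F (GL 2 F)/gzero F (GL 2 F)]_(1 <= i < m.+1 | odd i)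
              gtens (gtpow (Vdet F) i) (Vhom F (2 * m - 2 * i))),
         gisomorphic (gsym2 (Vhom F m))
           (\big[@gdsum F (GL 2 F)/gzero F (GL 2 F)]_(0 <= i < m.+1 | ~~ odd i)
              gtens (gtpow (Vdet F) i) (Vhom F (2 * m - 2 * i)))
       & forall i, i <= m ->
           girreducible (gtens (gtpow (Vdet F) i) (Vhom F (2 * m - 2 * i)))]).
Proof.
split=> [/pchar_natf_neq0 nat_neq0|/pchar_natf_neq0].
  split=> [|i _]; first exact: clebsch_gordan.
  apply: twist_irreducible => j /andP[j0 jk].
  by rewrite nat_neq0 // j0 (leq_trans jk) // leq_subr.
(* The squares are quotients of the tensor product with [n = m], whose degrees are written with
   [m + m]. *)
have -> : 2 * m = m + m by rewrite mul2n addnn.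
move=> nat_neq0; have two_neq0 : (2%:R != 0 :> F)%R by move: char_neq2; rewrite inE.
split=> [||i _]; [exact: exterior_square | exact: symmetric_square |].
apply: twist_irreducible => j /andP[j0 jk].
by rewrite nat_neq0 // j0 (leq_trans jk) // leq_subr.
Qed.
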